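(* Let $L$ and $J$ be $2n\times2n$ complex matrices with $L$ Hermitian and $J$ invertible and skew-Hermitian, and let $\mathcal L(\lambda):=L-\lambda K$ with $K:=(iJ)^{-1}$. Let $2n_{\mathrm u}$ be the total algebraic multiplicity of all eigenvalues $\nu$ of $JL$ with $\operatorname{Re}\nu\neq0$. Then \[ n_{\mathrm u}=N_-(L)-\zeta-\sum_{\lambda\in\sigma(\mathcal L),\,\lambda>0}\kappa^+(\lambda)-\sum_{\lambda\in\sigma(\mathcal L),\,\lambda<0}\kappa^-(\lambda), \] where \[ \zeta=\tfrac12\dim(\operatorname{gKer}(JL))-\tfrac12\bigl(Z^\downarrow_+(\mathcal L)+Z^\downarrow_-(\mathcal L)\bigr), \] or equivalently \[ \zeta=\tfrac12\bigl(\dim(\operatorname{gKer}(JL))-2\dim(\ker L)\bigr)+\tfrac12\bigl(Z^\uparrow_+(\mathcal L)+Z^\uparrow_-(\mathcal L)\bigr). \]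
   Context: $\operatorname{gKer}(JL)$ is the generalized kernel of $JL$ (the algebraic eigenspace for eigenvalue $0$). $N_-(L)$ is the number of negative eigenvalues of $L$ with multiplicity. Characteristic values of $\mathcal L$ are the $\lambda$ with $\det\mathcal L(\lambda)=0$; $\sigma(\mathcal L)$ is their set, and the sums run over real characteristic values (which correspond to the purely imaginary eigenvalues $\nu=-i\lambda$ of $JL$). For real $\lambda$ the eigenvalues of the Hermitian matrix $\mathcal L(\lambda)$ can be chosen as $2n$ real analytic branches $\mu(\lambda)$. $Z^\downarrow_\pm(\mathcal L)$ (resp. $Z^\uparrow_\pm(\mathcal L)$) is the number of branches with $\mu(0)=0$ and $\mu(\lambda)<0$ (resp. $\mu(\lambda)>0$) for all sufficiently small $\pm\lambda>0$. Graphical Krein indices: for a real characteristic value $\lambda_0$ and a branch $\mu$ with $\mu^{(n)}(\lambda_0)=0$ for $n<m$, $\mu^{(m)}(\lambda_0)\ne0$, $\eta=\operatorname{sign}\mu^{(m)}(\lambda_0)$, set $\kappa^\pm(\mu,\lambda_0)=m/2$ if $m$ even and $(m\pm\eta)/2$ if $m$ odd; $\kappa^\pm(\lambda_0)$ is the sum over all branches vanishing at $\lambda_0$. *)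

(* Defs.v *)
(* mathcomp + mathcomp-analysis + real_closed (complex R = R[i]) *)
From HB Require Import structures.
From mathcomp Require Import all_boot all_order all_algebra.
From mathcomp Require Import all_classical all_reals all_analysis.
From mathcomp Require Import complex.
Set Implicit Arguments. Unset Strict Implicit. Unset Printing Implicit Defensive.
Import Order.TTheory GRing.Theory Num.Theory numFieldNormedType.Exports.
Local Open Scope ring_scope.

Section Defs.
Variable R : realType.
Local Notation C := (complex R).

(* embedding of reals into complexes *)
Definition rC (x : R) : C := real_complex R x.

(* conjugate transpose *)
Definition ctrmx k (A : 'M[C]_k) : 'M[C]_k := (map_mx (fun z : C => z^*) A)^T.
Definition hermitian_mx k (A : 'M[C]_k) : Prop := ctrmx A = A.
Definition skew_hermitian_mx k (A : 'M[C]_k) : Prop := ctrmx A = - A.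

(* the eigenvalues of M listed with algebraic multiplicity: a sequence s such
   that char_poly M = \prod_(z <- s) ('X - z); unique up to permutation *)
Definition eig_seq k (M : 'M[C]_k) : seq C :=
  xget [::] [set s : seq C | char_poly M = \prod_(z <- s) ('X - z%:P)].

(* N_-(L): number of negative eigenvalues, with multiplicity *)
Definition Nneg k (L : 'M[C]_k) : nat := count (fun z : C => z < 0) (eig_seq L).

(* dim gKer(M): dimension of the generalized kernel ker (M^k) *)
Definition dim_gker k (M : 'M[C]_k) : nat := \rank (kermx (M ^+ k)).

(* K := (iJ)^{-1},  pencil L(lambda) = L - lambda K *)
Definition Kmat k (J : 'M[C]_k) : 'M[C]_k := invmx ('i *: J).
Definition pencil k (L J : 'M[C]_k) (l : C) : 'M[C]_k := L - l *: Kmat J.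

(* real analyticity: locally the sum of a convergent power series *)
Definition real_analytic (f : R -> R) : Prop :=
  forall x0 : R, exists (a : nat -> R) (r : R), 0 < r /\
    forall x : R, `|x - x0| < r ->
      ((fun N : nat => \sum_(i < N) a i * (x - x0) ^+ i) @ \oo --> f x)%classic.

(* order of vanishing: the least m with f^(m)(x) <> 0 *)
Definition vorder (f : R -> R) (x : R) : nat :=
  xget 0%N [set m : nat | (forall k, (k < m)%N -> derive1n k f x = 0)
                          /\ derive1n m f x != 0].

(* graphical Krein index of a branch; s = true for kappa^+, false for kappa^- *)
Definition kappa_branch (s : bool) (f : R -> R) (x : R) : R :=
  let m := vorder f x in
  let eta := Num.sg (derive1n m f x) in
  if odd m then (m%:R + (if s then eta else - eta)) / 2 else m%:R / 2.

Definition kappa k (s : bool) (mu : 'I_k -> R -> R) (x : R) : R :=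
  \sum_(j < k | mu j x == 0) kappa_branch s (mu j) x.

(* Z^down_+, Z^down_-, Z^up_+, Z^up_- *)
Definition Zdown_p k (mu : 'I_k -> R -> R) : nat :=
  #|[set j : 'I_k | `[< mu j 0 = 0 /\ exists e : R, 0 < e /\
        forall l : R, 0 < l < e -> mu j l < 0 >]]|.
Definition Zdown_m k (mu : 'I_k -> R -> R) : nat :=
  #|[set j : 'I_k | `[< mu j 0 = 0 /\ exists e : R, 0 < e /\
        forall l : R, - e < l < 0 -> mu j l < 0 >]]|.
Definition Zup_p k (mu : 'I_k -> R -> R) : nat :=
  #|[set j : 'I_k | `[< mu j 0 = 0 /\ exists e : R, 0 < e /\
        forall l : R, 0 < l < e -> 0 < mu j l >]]|.
Definition Zup_m k (mu : 'I_k -> R -> R) : nat :=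
  #|[set j : 'I_k | `[< mu j 0 = 0 /\ exists e : R, 0 < e /\
        forall l : R, - e < l < 0 -> 0 < mu j l >]]|.

(* sum over the real characteristic values lambda of the pencil with P lambda *)
Definition sum_charval k (L J : 'M[C]_k) (P : R -> Prop) (F : R -> R) : R :=
  (\sum_(l \in [set l : R | P l /\ \det (pencil L J (rC l)) = 0]) F l)%classic.

End Defs.

(* Main.v *)
Require Import Defs.
From HB Require Import structures.
From mathcomp Require Import all_boot all_order all_algebra.
From mathcomp Require Import all_classical all_reals all_analysis.
From mathcomp Require Import complex ring lra.
Import Order.TTheory GRing.Theory Num.Theory numFieldNormedType.Exports.
Local Open Scope ring_scope.

(** The product of the branches, det (L - l K), equals up to a nonzero constant
    the characteristic polynomial of JL at -i l, so the vanishing orders of the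
    branches at a real x add up to the algebraic multiplicity of the eigenvalue
    -i x of JL.  Along a branch, the indices kappa at the zeros in an interval
    sum to half of the total order, plus (l > 0) or minus (l < 0) half of the
    signs of the leading coefficients at the odd zeros, and these signs
    telescope to half the difference of the signs of the branch at the two ends.
    At 0 the signs are counted by N_-(L) and the Z-numbers.  At infinity,
    t mu(1/t) is an eigenvalue of t L - K, and both one-sided limits t -> 0 give
    the spectrum of -K, which misses 0; hence the signs of all the branches at
    +oo and at -oo add up to 0. *)

Set Implicit Arguments.
Unset Strict Implicit.
Unset Printing Implicit Defensive.

(** * Kernels and characteristic polynomials *)

(** Both sides are [x ^+ r] times the determinant of the block matrix [T]: a column operation clears
    its lower left block and leaves [x%:M - A *m B], while a row operation scaled by [x] clears it
    and leaves [x%:M - B *m A]. The scaling avoids a division by [x]. *)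
Lemma det_subM_sylvester (R : comNzRingType) k r (A : 'M[R]_(k, r)) (B : 'M[R]_(r, k)) x :
  \det (x%:M - A *m B) * x ^+ r = x ^+ k * \det (x%:M - B *m A).
Proof.
pose T := block_mx x%:M A B 1%:M.
have <- : \det T = \det (x%:M - A *m B).
  have := det_mulmx T (block_mx 1%:M 0 (- B) 1%:M).
  rewrite mulmx_block !mulmx1 !mulmx0 mulmxN mul1mx subrr add0r add0r.
  by rewrite det_ublock det_lblock !det1 !mulr1 => <-.
have := det_mulmx (block_mx 1%:M 0 (- B) x%:M) T.
rewrite mulmx_block !mul1mx !mul0mx !addr0 mulNmx mul_mx_scalar mul_scalar_mx.
rewrite mulmx1 addNr mulNmx [- (B *m A) + _]addrC det_ublock det_lblock det1 mul1r !det_scalar.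
by move=> eqT; rewrite mulrC -eqT.
Qed.

Section Field.
Variable F : fieldType.

(** The rank condition makes the geometric and the algebraic multiplicity of 0 agree. It holds for
    Hermitian matrices and for high enough powers of any matrix. *)
Lemma rank_ker_count0 k (N : 'M[F]_k) s :
  \rank (N *m N) = \rank N -> char_poly N = \prod_(z <- s) ('X - z%:P) ->
  \rank (kermx N) = count_mem 0 s.
Proof.
move=> rN2 cN.
(* Through a rank factorization N = A B with B A invertible, the char. polynomial
   of N is a power of X times the one of B A. *)
pose A := col_base N; pose B := row_base N.
(* [N *m N] factors through the square matrix [B *m A] of size [\rank N], so the rank of [B *m A] is
   at least that of [N *m N], which is [\rank N]. *)
have BAu : B *m A \in unitmx.
  rewrite -row_free_unit -row_leq_rank -[X in (X <= _)%N]rN2.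
  rewrite -{1 2}(mulmx_base N) -/A -/B -mulmxA mulmxA -mulmxA.
  rewrite (leq_trans (mxrankM_maxr _ _)) // mulmxA.
  exact: mxrankM_maxl.
have := det_subM_sylvester (map_mx polyC A) (map_mx polyC B) 'X.
rewrite -!map_mxM mulmx_base -/(char_poly_mx _) -/(char_poly_mx _).
(* Multiplicities of the root 0 are compared: 0 is not a root of the characteristic polynomial of
   [B *m A], so the count plus [\rank N] equals [k]. *)
rewrite -/(char_poly _) -/(char_poly _) cN => /(congr1 (mup 0)).
have nz m (M : 'M[F]_m) : char_poly M != 0 by rewrite monic_neq0 ?char_poly_monic.
have XE m : 'X^m = ('X - 0%:P) ^+ m :> {poly F} by rewrite subr0.
rewrite !XE !mupM ?expf_neq0 ?polyXsubC_eq0 ?nz //; last first.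
  by rewrite monic_neq0 ?monic_prod_XsubC.
rewrite !mup_XsubCX eqxx mu_prod_XsubC [X in (k + X)%N]mupNroot; last first.
  rewrite rootE horner_coef0 char_poly_det mulf_neq0 //.
    by rewrite signr_eq0.
  by rewrite -unitfE -unitmxE.
rewrite addn0 => eqk; apply/eqP.
by rewrite mxrank_ker -(eqn_add2r (\rank N)) subnK ?rank_leq_row // eqk.
Qed.

Lemma char_poly_conj k (P A B : 'M[F]_k) :
  P \in unitmx -> P *m A = B *m P -> char_poly A = char_poly B.
Proof.
move=> uP PA; pose Q := map_mx polyC P.
have : \det (Q *m char_poly_mx A) = \det (char_poly_mx B *m Q).
  by rewrite mulmxBr mulmxBl -!map_mxM PA scalar_mxC.
rewrite !det_mulmx [RHS]mulrC; apply: mulfI.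
by rewrite /Q det_map_mx polyC_eq0 -unitfE -unitmxE.
Qed.

Lemma trig_mulmx k (A B : 'M[F]_k) : is_trig_mx A -> is_trig_mx B ->
  is_trig_mx (A *m B) /\ forall i, (A *m B) i i = A i i * B i i.
Proof.
move=> /is_trig_mxP tA /is_trig_mxP tB; split.
  apply/is_trig_mxP => i j ltij; rewrite mxE big1 // => l _.
  have [lil|lli] := ltnP i l; first by rewrite tA // mul0r.
  by rewrite tB ?mulr0 // (leq_ltn_trans lli).
move=> i; rewrite mxE (bigD1 i) //= big1 ?addr0 // => l nli.
have [lil|lli] := ltnP i l; first by rewrite tA // mul0r.
by rewrite tB ?mulr0 // ltn_neqAle nli.
Qed.

(** Write the characteristic polynomial as [q * 'X^a] with 0 not a root of [q] and [a <= k.+1]. A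
    Bezout relation between ['X^(k.+1)] and [q], multiplied by ['X^(k.+1)], gives by Cayley-Hamilton
    that [M ^+ k.+1] is a multiple of its own square. *)
Lemma rank_expmx_stable k (M : 'M[F]_k.+1) : \rank (M ^+ k.+1 *m M ^+ k.+1) = \rank (M ^+ k.+1).
Proof.
have nz : char_poly M != 0 by rewrite monic_neq0 ?char_poly_monic.
have [a [q]] := multiplicity_XsubC (char_poly M) 0.
rewrite nz /= subr0 => nq0 cE.
have nq : q != 0 by apply: contraNneq nz => q0; rewrite cE q0 mul0r.
have ak : (a <= k.+1)%N.
  have := size_char_poly M; rewrite cE size_mulXn // => /eqP.
  have : (0 < size q)%N by rewrite size_poly_gt0.
  by case: (size q) => // m _; rewrite addnS eqSS => /eqP <-; apply: leq_addr.
have cop : coprimep ('X^(k.+1) : {poly F}) q.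
  by rewrite coprimep_sym -['X]subr0 coprimep_expr // coprimep_XsubC.
have /Bezout_eq1_coprimepP[[u v] /= uv] := cop.
apply/eqP; rewrite eqn_leq mxrankM_maxl /=.
suff {1}-> : M ^+ k.+1 = horner_mx M u *m (M ^+ k.+1 *m M ^+ k.+1) by exact: mxrankM_maxr.
have vq : v * q * 'X^(k.+1) = v * 'X^(k.+1 - a) * char_poly M.
  by rewrite cE -mulrACA -exprD subnK.
have := congr1 (fun p => horner_mx M (p * 'X^(k.+1))) uv.
rewrite mul1r mulrDl rmorphD /= vq [horner_mx M (_ * char_poly M)]rmorphM /=.
by rewrite Cayley_Hamilton mulr0 addr0 !rmorphM !rmorphXn /= horner_mx_X -mulrA => e; rewrite -[LHS]e.
Qed.

End Field.

(** By Schur triangularization the eigenvalues of [M ^+ k] are the k-th powers of those of [M], and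
    for k > 0 they vanish for the same indices. The rank of [M ^+ k] is stable under squaring, so
    its kernel has the dimension of the algebraic multiplicity of 0. *)
Lemma rank_gker_count (C : numClosedFieldType) k (M : 'M[C]_k) (s : seq C) :
  char_poly M = \prod_(z <- s) ('X - z%:P) ->
  \rank (kermx (M ^+ k)) = count_mem 0 s.
Proof.
case: k M => [|k] M cM.
  have /eqP : size (char_poly M) = 1%N by rewrite size_char_poly.
  rewrite cM size_prod_XsubC eqSS size_eq0 => /eqP -> /=.
  by apply/eqP; rewrite -leqn0 rank_leq_row.
have [P /unitarymx_unit uP] := Schur M isT.
rewrite /mxred.similar_to /= /in_mem /= mxred.conjumx // => tT.
set T := _ *m invmx P in tT.
have PM : P *m M = T *m P by rewrite mulmxKV.
have PMX m : P *m (M ^+ m) = (T ^+ m) *m P.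
  elim: m => [|m IH]; first by rewrite !expr0 mulmx1 mul1mx.
  by rewrite !exprS -!mulmxE mulmxA PM -mulmxA IH mulmxA.
have tTX m : is_trig_mx (T ^+ m) /\ forall i, (T ^+ m) i i = T i i ^+ m.
  elim: m => [|m [IH1 IH2]].
    by split=> [|i]; rewrite expr0 ?mxE ?eqxx ?expr0 //; apply: scalar_mx_is_trig.
  have [t d] := trig_mulmx tT IH1; rewrite exprS -mulmxE; split=> // i.
  by rewrite d IH2 exprS.
have cMk : char_poly (M ^+ k.+1) = \prod_(z <- [seq T i i ^+ k.+1 | i <- enum 'I_k.+1]) ('X - z%:P).
  rewrite (char_poly_conj uP (PMX _)) char_poly_trig; last by case: (tTX k.+1).
  rewrite big_map big_enum; apply: eq_bigr => i _.
  by case: (tTX k.+1) => _ ->.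
rewrite (rank_ker_count0 (rank_expmx_stable M) cMk) [LHS]count_map.
have /prod_XsubC_eq/permP -> : \prod_(z <- s) ('X - z%:P) =
   \prod_(z <- [seq T i i | i <- enum 'I_k.+1]) ('X - z%:P).
  rewrite -cM (char_poly_conj uP PM) char_poly_trig // big_map big_enum.
  by apply: eq_bigr.
by rewrite [in RHS]count_map; apply: eq_count => i /=; rewrite expf_eq0.
Qed.

(** If [u *m (L *m L)] is 0, then so is the squared norm of [u *m L], because [L] is its own
    adjoint. Hence [L *m L] and [L] have the same kernel. *)
Lemma rank_hermitian_sqr (C : numClosedFieldType) k (L : 'M[C]_k) :
  (map_mx (fun z : C => z^*) L)^T = L -> \rank (L *m L) = \rank L.
Proof.
move=> hL; apply/eqP; rewrite eqn_leq mxrankM_maxl /=.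
have ker0 (u : 'rV[C]_k) : u *m (L *m L) = 0 -> u *m L = 0.
  move=> uLL; have : ((u *m L) *m (map_mx (fun z : C => z^*) (u *m L))^T) 0 0 = 0.
    by rewrite map_mxM trmx_mul hL mulmxA -(mulmxA u) uLL mul0mx mxE.
  rewrite mxE => /psumr_eq0P w0; apply/rowP => j; rewrite [RHS]mxE.
  apply/eqP; rewrite -mul_conjC_eq0; apply/eqP.
  have := w0 _ j isT; rewrite !mxE; apply=> i _.
  by rewrite !mxE mul_conjC_ge0.
have : (kermx (L *m L) <= kermx L)%MS.
  by apply/rV_subP => u /sub_kermxP/ker0 u0; apply/sub_kermxP.
move/mxrankS; rewrite !mxrank_ker => h.
by rewrite -(leq_sub2lE _ (rank_leq_row _)).
Qed.

Lemma horner_char_poly (F : comNzRingType) k (A : 'M[F]_k) z :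
  (char_poly A).[z] = \det (z%:M - A).
Proof.
rewrite -[LHS]/(horner_eval z _) /char_poly -det_map_mx; congr (\det _).
apply/matrixP => i j; rewrite !mxE /= /horner_eval !hornerE.
by rewrite hornerMn hornerX.
Qed.

HB.instance Definition _ (R : realType) := GRing.RMorphism.copy (@rC R) (real_complex R).

Section RealAnalysis.
Local Open Scope classical_set_scope.

Lemma ultra_fmap (T U : Type) (f : T -> U) (G : set_system T) :
  UltraFilter G -> UltraFilter (fmap f G).
Proof.
move=> UG; split; first exact: fmap_proper_filter.
move=> H PH GH; apply/seteqP; split=> [A HA|]; last exact: GH.
have [//|GnA] := in_ultra_setVsetC (f @^-1` A) UG.
have HnA : H (~` A) by apply: GH.
by have [x []] := filter_ex (filterI HA HnA).
Qed.

Variable R : realType.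
Implicit Types (f : R -> R) (x a : R) (m : nat).
Local Notation C := (complex R).

(** * Local orders of real analytic functions *)

(** Each of the [i.+1] terms of the geometric sum up to [q ^+ i] is at least [q ^+ i]. *)
Lemma succ_mul_expr_le (q : R) i : 0 <= q < 1 -> i.+1%:R * q ^+ i <= (1 - q)^-1.
Proof.
move=> /andP[q0 q1]; rewrite -[leRHS]mul1r ler_pdivlMr ?subr_gt0 //.
have : i.+1%:R * q ^+ i <= \sum_(j < i.+1) q ^+ j.
  rewrite mulr_natl -[X in _ *+ X](card_ord i.+1) -sumr_const.
  by apply: ler_sum => j _; apply: ler_wiXn2l => //; [exact: ltW|rewrite -ltnS].
move=> /(ler_wpM2r (_ : 0 <= 1 - q)) h; apply: le_trans (h _) _.
  by rewrite subr_ge0 ltW.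
have := subrX1 q i.+1; rewrite mulrC => /(congr1 -%R).
rewrite -mulrN !opprB => <-.
by rewrite lerBlDr lerDl exprn_ge0.
Qed.

(** With [y] strictly between the moduli of [x] and [K], and [q] the ratio of the modulus of [x] to
    [y], the factor [i.+1] of the differentiated series is absorbed by [q ^+ i]. What remains is
    dominated by the absolute series at [y] without its first term. *)
Lemma is_cvg_pseries_diffs (c : nat -> R) (K x : R) :
  cvgn (pseries c K) -> `|x| < `|K| -> cvgn (pseries (pseries_diffs c) x).
Proof.
move=> cK xK.
pose y := (`|x| + `|K|) / 2; have y0 : 0 < y by have := normr_ge0 x; rewrite /y; lra.
have xy : `|x| < y by rewrite /y; lra.
have yK : y < `|K| by rewrite /y; lra.
pose q := `|x| / y.
have q01 : 0 <= q < 1 by rewrite divr_ge0 ?(ltW y0) //= ltr_pdivrMr // mul1r.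
have cy : cvgn (pseries (fun i => `|c i|) y).
  by apply: is_cvg_pseries_inside_norm cK _; rewrite (gtr0_norm y0).
apply: normed_cvg; rewrite /=.
apply: (@series_le_cvg _ _ (fun i => (1 - q)^-1 / y * (`|c i.+1| * y ^+ i.+1))) => [i|i|i|].
- exact: normr_ge0.
- by rewrite !mulr_ge0 ?invr_ge0 ?exprn_ge0 ?(ltW y0) // subr_ge0 ltW //; case/andP: q01.
- rewrite /= /pseries_diffs !normrM normrX normr_nat.
  have -> : `|x| ^+ i = q ^+ i * y ^+ i by rewrite -exprMn /q divfK // gt_eqF.
  have := succ_mul_expr_le i q01 => h.
  have -> : (1 - q)^-1 / y * (`|c i.+1| * y ^+ i.+1) = (1 - q)^-1 * (`|c i.+1| * y ^+ i).
    by rewrite exprS -mulrA; congr (_ * _); field; rewrite gt_eqF.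
  have -> : i.+1%:R * `|c i.+1| * (q ^+ i * y ^+ i) = i.+1%:R * q ^+ i * (`|c i.+1| * y ^+ i) by ring.
  by rewrite ler_wpM2r // mulr_ge0 // exprn_ge0 // ltW.
- apply: is_cvg_seriesZ.
  have {}cy : cvgn (fun n => pseries (fun i => `|c i|) y n.+1).
    by apply/cvg_ex; exists (limn (pseries (fun i => `|c i|) y)); rewrite cvg_shiftS.
  have -> : series (fun i => `|c i.+1| * y ^+ i.+1) =
      fun n => pseries (fun i => `|c i|) y n.+1 - `|c 0%N| * y ^+ 0.
    by apply/funext => n; rewrite /pseries /series /= big_nat_recl // addrAC subrr add0r.
  by apply: is_cvgB => //; apply: is_cvg_cst.
Qed.

Lemma near_dist_lt (x e : R) : 0 < e -> \forall y \near x, `|x - y| < e.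
Proof. by move=> e0; have /cvgrPdist_lt := @cvg_id _ (nbhs x); apply. Qed.

Definition expands (f : R -> R) (x0 r : R) (c : nat -> R) := forall x,
  `|x - x0| < r -> cvgn (pseries c (x - x0)) /\ f x = limn (pseries c (x - x0)).

Lemma expandsE (f : R -> R) x0 r (c : nat -> R) : (forall x, `|x - x0| < r ->
  ((fun N : nat => \sum_(i < N) c i * (x - x0) ^+ i) @ \oo --> f x)) ->
  expands f x0 r c.
Proof.
move=> h x /h; have -> : (fun N => \sum_(i < N) c i * (x - x0) ^+ i) = pseries c (x - x0).
  by apply/funext => N; rewrite /pseries /series /= big_mkord.
by move=> cf; split; [apply/cvg_ex; exists (f x)|rewrite (cvg_lim _ cf)].
Qed.

Lemma pseries0_lim (c : nat -> R) : pseries c 0 @ \oo --> c 0%N.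
Proof.
rewrite -cvg_shiftS.
have -> : [sequence pseries c 0 n.+1]_n = cst (c 0%N); last exact: cvg_cst.
apply/funext => n; rewrite /pseries /series /= big_nat_recl // expr0 mulr1.
by rewrite big1 ?addr0 // => i _; rewrite exprS mul0r mulr0.
Qed.

Lemma expands_center f x0 r c : 0 < r -> expands f x0 r c -> f x0 = c 0%N.
Proof.
move=> r0 /(_ x0); rewrite subrr normr0 => /(_ r0)[_ ->].
exact: cvg_lim (@pseries0_lim c).
Qed.

Lemma expands_is_derive f x0 r c x : expands f x0 r c -> `|x - x0| < r ->
  cvgn (pseries (pseries_diffs c) (x - x0)) /\
  is_derive x 1 f (limn (pseries (pseries_diffs c) (x - x0))).
Proof.
move=> fc xr.
have cvK (d e : R) : 0 <= d -> d < e -> e < r -> cvgn (pseries c e).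
  move=> d0 de er; have := fc (x0 + e); rewrite [x0 + e]addrC addrK => -[] //.
  by rewrite gtr0_norm // (le_lt_trans d0).
pose d := `|x - x0|; have d0 : 0 <= d by exact: normr_ge0.
(* Term by term differentiation needs the series and its first two formal derivatives to converge at
   a point beyond [d]. Each formal derivative costs a little radius, hence three nested radii
   between [d] and [r]. *)
pose K1 := d + (r - d) / 4; pose K2 := d + (r - d) / 2; pose K3 := d + (r - d) * 3 / 4.
have dr : d < r by [].
have K3r : K3 < r by rewrite /K3; lra.
have K23 : K2 < K3 by rewrite /K3 /K2; lra.
have K12 : K1 < K2 by rewrite /K1 /K2; lra.
have dK1 : d < K1 by rewrite /K1; lra.
have n1 : `|K1| = K1 by rewrite gtr0_norm //; lra.
have n2 : `|K2| = K2 by rewrite gtr0_norm //; lra.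
have n3 : `|K3| = K3 by rewrite gtr0_norm //; lra.
have c3 : cvgn (pseries c K3) by apply: (cvK d); lra.
have c2 : cvgn (pseries (pseries_diffs c) K2) by apply: is_cvg_pseries_diffs c3 _; rewrite n2 n3.
have c1 : cvgn (pseries (pseries_diffs (pseries_diffs c)) K1).
  by apply: is_cvg_pseries_diffs c2 _; rewrite n1 n2.
have c21 : cvgn (pseries (pseries_diffs c) K1) by apply: is_cvg_pseries_inside c2 _; rewrite n1 n2.
have c31 : cvgn (pseries c K1) by apply: is_cvg_pseries_inside c3 _; rewrite n1 n3; lra.
split; first by apply: is_cvg_pseries_inside c21 _; rewrite n1.
have dl : is_derive (x - x0) (1 : R) (fun z => limn (pseries c z))
    (limn (pseries (pseries_diffs c) (x - x0))).
  by apply: pseries_snd_diffs c31 c21 c1 _; rewrite n1.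
have ds : is_derive x (1 : R) (fun y => y - x0) 1.
  by rewrite -[X in is_derive _ _ _ X]subr0; apply: is_deriveB.
have dc := @is_derive1_comp R (fun z => limn (pseries c z)) (fun y => y - x0) x _ _ dl ds.
rewrite mulr1 in dc.
have fE : {near x, (fun z => limn (pseries c z)) \o (fun y => y - x0) =1 f}.
  have : \forall y \near x, `|x - y| < r - d by apply: near_dist_lt; rewrite subr_gt0.
  apply: filterS => y xy /=; suff /fc[_ ->] : `|y - x0| < r by [].
  have -> : y - x0 = (x - x0) - (x - y) by lra.
  by apply: le_lt_trans (ler_normB _ _) _; rewrite -/d; lra.
exact: near_eq_is_derive fE dc.
Qed.

Lemma expands_derive1n f x0 r c k : expands f x0 r c ->
  expands (derive1n k f) x0 r (iter k (@pseries_diffs R) c).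
Proof.
move=> fc; elim: k => [|k IH] //= x xr.
have [cd dd] := expands_is_derive IH xr; split=> //.
by rewrite derive1E (@derive_val _ _ _ _ _ _ _ dd).
Qed.

Lemma iter_pseries_diffs (c : nat -> R) k i :
  iter k (@pseries_diffs R) c i = ((i + k) ^_ k)%:R * c (i + k)%N.
Proof.
elim: k i => [|k IH] i /=; first by rewrite addn0 ffactn0 mul1r.
rewrite {1}/pseries_diffs IH addSnnS mulrA -natrM; congr (_%:R * _).
by rewrite ffactnSr addnS -addSn addnK mulnC.
Qed.

Lemma expands_shift f x0 r c : c 0%N = 0 -> expands f x0 r c ->
  exists2 g, expands g x0 r (fun i => c i.+1) & forall x, `|x - x0| < r -> f x = (x - x0) * g x.
Proof.
move=> c0 fc; pose c' i := c i.+1.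
have pS z n : pseries c z n.+1 = z * pseries c' z n.
  rewrite /pseries /series /= big_nat_recl // c0 mul0r add0r mulr_sumr.
  by apply: eq_bigr => i _; rewrite exprS mulrCA.
have cv x : `|x - x0| < r -> cvgn (pseries c' (x - x0)).
  move=> /fc[cx _]; have [z0|nz] := eqVneq (x - x0) 0.
    by rewrite z0; apply/cvg_ex; exists (c' 0%N); exact: pseries0_lim.
  have -> : pseries c' (x - x0) = fun n => (x - x0)^-1 * pseries c (x - x0) n.+1.
    by apply/funext => n; rewrite pS mulKf.
  apply: is_cvgMr; apply/cvg_ex.
  by exists (limn (pseries c (x - x0))); rewrite (cvg_shiftS (pseries c (x - x0))).
exists (fun x => limn (pseries c' (x - x0))) => x xr; first by split=> //; exact: cv.
have [cx ->] := fc x xr; apply: cvg_lim => //.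
rewrite -cvg_shiftS.
have -> : [sequence pseries c (x - x0) n.+1]_n = fun n => (x - x0) * pseries c' (x - x0) n.
  by apply/funext => n; rewrite /= pS.
by apply: cvgMr; exact: cv.
Qed.

Lemma expands_continuous f x0 r c : 0 < r -> expands f x0 r c -> {for x0, continuous f}.
Proof.
move=> r0 fc; have [|_ [df _]] := @expands_is_derive f x0 r c x0 fc.
  by rewrite subrr normr0.
by apply: differentiable_continuous; apply/derivable1_diffP.
Qed.

(** A factorization replaces derivatives here, so that orders add up over products of branches. The
    leading coefficient [a] is a Taylor coefficient: the m-th derivative of an analytic [f] is [m!]
    times it. *)
Definition has_order (f : R -> R) x m (a : R) := a != 0 /\ exists g : R -> R,
  [/\ {for x, continuous g}, g x = a & \forall y \near x, f y = (y - x) ^+ m * g y].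

Lemma expands_factor f x0 r c m : 0 < r -> (forall k, (k < m)%N -> c k = 0) ->
  expands f x0 r c ->
  exists2 g, {for x0, continuous g} & g x0 = c m /\ \forall x \near x0, f x = (x - x0) ^+ m * g x.
Proof.
move=> r0; elim: m => [|m IH] in f c *.
  move=> _ fc; exists f; first exact: expands_continuous fc.
  by split; [exact: expands_center fc|near=> x; rewrite expr0 mul1r].
move=> c0 fc; have [g gc fg] := expands_shift (c0 0%N isT) fc.
have [h hc [hx gh]] := IH g _ (fun k km => c0 k.+1 km) gc.
exists h => //; split=> //.
have : \forall y \near x0, `|x0 - y| < r by exact: near_dist_lt.
move: gh; apply: filterS2 => y gy yr; rewrite fg; last by rewrite distrC.
by rewrite gy mulrA exprS.
Unshelve. all: by end_near. Qed.

(** The k-th derivative at [x] is [k!] times the k-th coefficient of the expansion. Either all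
    coefficients vanish, or the first nonzero one gives the order and the leading coefficient. *)
Lemma real_analytic_order f x : real_analytic f ->
  (\forall y \near x, f y = 0) \/
  exists m a, [/\ has_order f x m a, forall k, (k < m)%N -> derive1n k f x = 0
    & derive1n m f x = m`!%:R * a].
Proof.
move=> /(_ x)[c [r [r0 /expandsE fc]]].
have dE k : derive1n k f x = k`!%:R * c k.
  rewrite (expands_center r0 (expands_derive1n k fc)) iter_pseries_diffs.
  by rewrite add0n ffactnn.
have [[m cm]|nc] := pselect (exists m, c m != 0); last first.
  have c0 k : c k = 0 by apply/eqP/negPn/negP => ck; apply: nc; exists k.
  left; have : \forall y \near x, `|x - y| < r by exact: near_dist_lt.
  apply: filterS => y; rewrite distrC => /fc[_ ->].
  have -> : pseries c (y - x) = cst 0; last exact: lim_cst.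
  by apply/funext => n; rewrite /pseries /series /= big1 // => i _; rewrite c0 mul0r.
right; pose p := [pred m | c m != 0].
have ep : exists m, p m by exists m.
case: (ex_minnP ep) => {cm}m /= cm mmin.
have c0 k : (k < m)%N -> c k = 0.
  by move=> km; apply: contraTeq km => ck; rewrite -leqNgt; exact: mmin.
have [g gc [gx fg]] := expands_factor r0 c0 fc.
exists m, (c m); split=> //; first by split=> //; exists g.
by move=> k km; rewrite dE c0 ?mulr0.
Qed.

Lemma near_at_right x (P : set R) : (\forall y \near x, P y) -> \forall y \near x^'+, P y.
Proof. exact: cvg_within. Qed.

Lemma near_at_left x (P : set R) : (\forall y \near x, P y) -> \forall y \near x^'-, P y.
Proof. exact: cvg_within. Qed.

Lemma has_order_mul f1 f2 x m1 m2 a1 a2 : has_order f1 x m1 a1 ->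
  has_order f2 x m2 a2 -> has_order (fun y => f1 y * f2 y) x (m1 + m2) (a1 * a2).
Proof.
move=> [n1 [g1 [c1 e1 f1E]]] [n2 [g2 [c2 e2 f2E]]]; split; first by rewrite mulf_neq0.
exists (fun y => g1 y * g2 y); split; [exact: cvgM|by rewrite e1 e2|].
by move: f1E f2E; apply: filterS2 => y -> ->; rewrite exprD mulrACA.
Qed.

Lemma has_order0 f x : {for x, continuous f} -> f x != 0 -> has_order f x 0 (f x).
Proof.
move=> cf nf; split=> //; exists f; split=> //; near=> y.
by rewrite expr0 mul1r.
Unshelve. all: by end_near. Qed.

Lemma has_order_prod I (s : seq I) (f : I -> R -> R) x (m : I -> nat) :
  (forall i, exists a, has_order (f i) x (m i) a) ->
  exists a, has_order (fun y => \prod_(i <- s) f i y) x (\sum_(i <- s) m i) a.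
Proof.
move=> fo; elim: s => [|i s [a IH]].
  exists 1; rewrite big_nil.
  have -> : (fun y : R => \prod_(i <- [::]) f i y) = cst 1.
    by apply/funext => y; rewrite big_nil.
  by apply: has_order0; [exact: cvg_cst|exact: oner_neq0].
have [b fb] := fo i; exists (b * a); rewrite big_cons.
have -> : (fun y => \prod_(i <- i :: s) f i y) = fun y => f i y * \prod_(i <- s) f i y.
  by apply/funext => y; rewrite big_cons.
exact: has_order_mul.
Qed.

(** * Signs around and between zeros, and graphical Krein indices *)

Lemma has_order_sg_near f x m a : has_order f x m a ->
  \forall y \near x, Num.sg (f y) = Num.sg (y - x) ^+ m * Num.sg a.
Proof.
move=> [na [g [cg ga fE]]].
have : \forall y \near x, Num.sg (g y) = Num.sg a.
  rewrite -ga in na *; have [gn|gp|g0] := ltgtP (g x) 0.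
  - by near=> y; rewrite !ltr0_sg //; near: y; exact: cvgr_lt cg _ gn.
  - by near=> y; rewrite !gtr0_sg //; near: y; exact: cvgr_gt cg _ gp.
  - by rewrite g0 eqxx in na.
by move: fE; apply: filterS2 => y -> gy; rewrite sgrM sgrX gy.
Unshelve. all: by end_near. Qed.

Lemma has_order_sg_right f x m a : has_order f x m a ->
  \forall y \near x^'+, Num.sg (f y) = Num.sg a.
Proof.
move=> /has_order_sg_near/near_at_right fs.
near=> y; have -> // : Num.sg (f y) = Num.sg (y - x) ^+ m * Num.sg a by near: y.
by rewrite [Num.sg (y - x)]gtr0_sg ?expr1n ?mul1r // subr_gt0; near: y; exact: nbhs_right_gt.
Unshelve. all: by end_near. Qed.

Lemma has_order_sg_left f x m a : has_order f x m a ->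
  \forall y \near x^'-, Num.sg (f y) = (-1) ^+ m * Num.sg a.
Proof.
move=> /has_order_sg_near/near_at_left fs.
near=> y; have -> // : Num.sg (f y) = Num.sg (y - x) ^+ m * Num.sg a by near: y.
by rewrite [Num.sg (y - x)]ltr0_sg // subr_lt0; near: y; exact: nbhs_left_lt.
Unshelve. all: by end_near. Qed.

(** If [m' < m], dividing both factorizations by [(y - x) ^+ m'] and letting [y] tend to [x] from
    the right gives [a' = 0]. Used in both directions, this makes the order unique. *)
Lemma has_order_leq f x m m' a a' : has_order f x m a -> has_order f x m' a' -> (m <= m')%N.
Proof.
move=> [na [g [cg ga fE]]] [na' [g' [cg' ga' fE']]]; rewrite leqNgt; apply/negP => mm.
have e : \forall y \near x^'+, (y - x) ^+ (m - m') * g y = g' y.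
  near=> y; have xy : y - x != 0.
    by rewrite subr_eq0 gt_eqF //; near: y; exact: nbhs_right_gt.
  have : (y - x) ^+ m * g y = (y - x) ^+ m' * g' y.
    transitivity (f y); last by near: y; exact: near_at_right.
    by apply/esym; near: y; exact: near_at_right.
  rewrite -{1}(subnK (ltnW mm)) addnC exprD -mulrA; move/mulfI => -> //.
  by rewrite expf_neq0.
have l1 : g' y @[y --> x^'+] --> a' by rewrite -ga'; exact: cvg_at_right_filter.
have l2 : (y - x) ^+ (m - m') * g y @[y --> x^'+] --> (x - x) ^+ (m - m') * a.
  rewrite -ga; apply: cvg_at_right_filter; apply: cvgM => //.
  apply: (@continuous_comp _ _ _ (fun y => y - x) (fun y => y ^+ (m - m'))).
    by apply: continuousB; [exact: cvg_id|exact: cvg_cst].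
  exact: exprn_continuous.
rewrite subrr expr0n subn_eq0 leqNgt mm mul0r in l2.
have : a' = 0.
  apply: (@cvg_unique _ _ (g' y @[y --> x^'+])) => //.
  by apply: cvg_trans l2; exact: near_eq_cvg.
by move/eqP; apply/negP.
Unshelve. all: by end_near. Qed.

Lemma continuous_sg f u v : continuous f -> u <= v ->
  (forall y, u <= y <= v -> f y != 0) -> Num.sg (f u) = Num.sg (f v).
Proof.
move=> cf uv nz.
have nu : f u != 0 by apply: nz; rewrite lexx.
have nv : f v != 0 by apply: nz; rewrite lexx andbT.
have IV : Num.min (f u) (f v) <= 0 <= Num.max (f u) (f v) -> False.
  move=> h; have [y] := IVT uv (continuous_subspaceT cf) h.
  by rewrite in_itv /= => /nz /eqP.
have [un|up|/eqP] := ltgtP (f u) 0; last by rewrite (negbTE nu).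
- have [vn|vp|/eqP] := ltgtP (f v) 0; last by rewrite (negbTE nv).
    by rewrite !ltr0_sg.
  by exfalso; apply: IV; rewrite ge_min le_max (ltW un) (ltW vp) orbT.
- have [vn|vp|/eqP] := ltgtP (f v) 0; last by rewrite (negbTE nv).
    by exfalso; apply: IV; rewrite ge_min le_max (ltW up) (ltW vn) orbT.
  by rewrite !gtr0_sg.
Qed.

(** Across a point [x] of [s] the sign passes from [(-1) ^+ m x * Num.sg (c x)] to [Num.sg (c x)], a
    jump of twice the leading sign if the order is odd and none otherwise; elsewhere the sign is
    constant. The induction moves the left end [u] just past the first point of [s]. *)
Lemma sg_sum_orders f (m : R -> nat) (c : R -> R) (s : seq R) u v : continuous f ->
  (forall x, has_order f x (m x) (c x)) ->
  sorted <%R s -> all (fun x => u < x < v) s -> u <= v ->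
  (forall y, u <= y <= v -> y \notin s -> f y != 0) ->
  Num.sg (f v) - Num.sg (f u) = \sum_(x <- s) (if odd (m x) then Num.sg (c x) else 0) *+ 2.
Proof.
move=> cf fo; elim: s u => [|x s IH] u.
  move=> _ _ uv nz; rewrite big_nil (continuous_sg cf uv) ?subrr // => y yuv.
  exact: nz.
move=> srt /= /andP[/andP[ux xv] sv] uv nz.
have min_s : all (> x) s by apply: order_path_min srt; exact: lt_trans.
(* The next point of [s], or [v] if there is none: the new left end [w] is taken between [x] and
   [h]. *)
pose h := head v s.
have xh : x < h by rewrite /h; case: (s) min_s => //= y t /andP[].
have hv : h <= v by rewrite /h; case: (s) sv => //= y t /andP[/andP[_ /ltW]].
have hs y : y \in s -> h <= y.
  move: srt; rewrite /h /=; case: (s) => //= z t /andP[_ pz].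
  rewrite inE => /predU1P[->//|yt]; apply: ltW.
  by have /allP := order_path_min lt_trans pz; apply.
have [w [[xw wh] fw]] : exists w, (x < w /\ w < h) /\ Num.sg (f w) = Num.sg (c x).
  near x^'+ => w; exists w; split; last by near: w; exact: has_order_sg_right (fo x).
  by split; near: w; [exact: nbhs_right_gt|exact: nbhs_right_lt].
have [w' [[uw' w'x] fw']] : exists w', (u < w' /\ w' < x) /\ Num.sg (f w') = (-1) ^+ m x * Num.sg (c x).
  near x^'- => w'; exists w'; split; last by near: w'; exact: has_order_sg_left (fo x).
  by split; near: w'; [exact: nbhs_left_gt|exact: nbhs_left_lt].
have notin y : y < x -> y \notin x :: s.
  move=> yx; rewrite inE negb_or lt_eqF //=; apply/negP => /(allP min_s).
  by move=> /lt_trans/(_ yx); rewrite ltxx.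
have fu : Num.sg (f u) = Num.sg (f w').
  apply: continuous_sg => //; first exact: ltW.
  move=> y /andP[uy yw']; have yx := le_lt_trans yw' w'x.
  by apply: nz; [rewrite uy /= ltW // (lt_trans yx)|exact: notin].
rewrite big_cons -(IH w) ?(path_sorted srt) //.
- rewrite fu fw' fw -signr_odd; case: (odd _); rewrite ?expr1 ?expr0; ring.
- apply/allP => y ys; rewrite (lt_le_trans wh (hs _ ys)) /=.
  by have /andP[] := allP sv _ ys.
- by rewrite (le_trans (ltW wh)).
- move=> y /andP[wy yv] ys; apply: nz; first by rewrite yv (le_trans _ wy) // ltW // (lt_trans ux).
  by rewrite inE negb_or ys andbT gt_eqF // (lt_le_trans xw).
Unshelve. all: by end_near. Qed.

Lemma vorder_eq f x m : (forall k, (k < m)%N -> derive1n k f x = 0) ->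
  derive1n m f x != 0 -> vorder f x = m.
Proof.
move=> h0 h1; rewrite /vorder; case: xgetP => [p _ [p0 p1]|/(_ m)[]//].
have [pm|mp|//] := ltngtP p m; first by rewrite h0 ?eqxx in p1.
by rewrite p0 ?eqxx in h1.
Qed.

(** The factor [m!] is positive, so the sign in the Krein index is that of the leading coefficient
    [a]. Both indices then share the term [m / 2] and differ in the sign of the odd contribution. *)
Lemma real_analytic_vorder f x : real_analytic f ->
  ~ (\forall y \near x, f y = 0) -> exists2 a, has_order f x (vorder f x) a &
  forall s, kappa_branch s f x = (vorder f x)%:R / 2 +
     (-1) ^+ (~~ s) * (if odd (vorder f x) then Num.sg a else 0) / 2.
Proof.
move=> fa nz; have [//|[m [a [fo d0 dm]]]] := real_analytic_order x fa.
have m0 : 0 < m`!%:R :> R by rewrite ltr0n fact_gt0.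
have na : a != 0 by case: fo.
have vm : vorder f x = m by apply: vorder_eq; rewrite // dm mulf_neq0 // gt_eqF.
exists a; first by rewrite vm.
move=> s; rewrite /kappa_branch /= vm dm sgrM [Num.sg m`!%:R]gtr0_sg // mul1r.
by case: (odd m); case: s => /=; rewrite ?expr0 ?expr1; ring.
Qed.

Lemma has_order_vanish f x m a : has_order f x m a -> (f x == 0) = (0 < m)%N.
Proof.
move=> [na [g [_ ga /nbhs_singleton ->]]]; rewrite subrr mulf_eq0 ga (negbTE na) orbF.
by rewrite expf_eq0 eqxx andbT.
Qed.

(** * Eigenvalue branches near infinity *)

Lemma poly_ext_neq0 (p q : {poly R}) : (forall x, x != 0 -> p.[x] = q.[x]) -> p = q.
Proof.
move=> h; apply/eqP; rewrite -subr_eq0; apply/negPn/negP => nz.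
pose s := [seq i.+1%:R : R | i <- iota 0 (size (p - q))].
have us : uniq s.
  rewrite map_inj_uniq ?iota_uniq // => i j /eqP; rewrite eqr_nat => /eqP[].
  by [].
have rs : all (root (p - q)) s.
  by apply/allP => _ /mapP[i _ ->]; rewrite rootE hornerD hornerN h ?subrr // pnatr_eq0.
by have := max_poly_roots nz rs us; rewrite size_map size_iota ltnn.
Qed.

(** The imaginary parts of the coefficients form a polynomial that vanishes off 0, hence is 0. This
    carries identities known only for nonzero [t] over to [t = 0] within real polynomials. *)
Lemma real_poly (p : {poly C}) (f : R -> R) :
  (forall t, t != 0 -> p.[rC t] = rC (f t)) ->
  exists r : {poly R}, (forall t, p.[rC t] = rC r.[t]) /\ forall t, t != 0 -> r.[t] = f t.
Proof.
move=> pf; pose re : {poly R} := \poly_(i < size p) complex.Re p`_i.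
pose im : {poly R} := \poly_(i < size p) complex.Im p`_i.
have E t : p.[rC t] = rC re.[t] + 'i%C * rC im.[t].
  rewrite horner_coef !horner_poly !rmorph_sum mulr_sumr -big_split /=.
  apply: eq_bigr => i _; rewrite {1}[p`_i]complexE !rmorphM !rmorphXn /=.
  by rewrite mulrDl mulrA.
have ReIm (a b : R) : rC a + 'i%C * rC b = (a +i* b)%C.
  by rewrite /rC; simpc.
have im0 : im = 0.
  apply: poly_ext_neq0 => t nt; have := pf t nt.
  by rewrite E ReIm horner0 => -[].
have pr t : p.[rC t] = rC re.[t] by rewrite E im0 horner0 /rC mulr0 addr0.
exists re; split=> // t nt; have := pf t nt; rewrite pr.
by move/complexI.
Qed.

(* Only bounded, the [h j] need not converge along [F]; an ultrafilter finer than
   [F] makes all of them converge at once. *)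
Lemma ultra_limit_roots (k : nat) (F : set_system R) (h : 'I_k -> R -> R)
    (r : R -> {poly R}) (B : R) (sg : 'I_k -> R) :
  ProperFilter F -> F --> (0 : R) ->
  (forall x, \forall t \near F, (r x).[t] = \prod_(j < k) (x - h j t)) ->
  (\forall t \near F, forall j, `|h j t| <= B) ->
  (forall j, \forall t \near F, Num.sg (h j t) = sg j) ->
  (r 0).[0] != 0 ->
  exists nu : 'I_k -> R, (forall x, \prod_(j < k) (x - nu j) = (r x).[0]) /\
     (forall j, Num.sg (nu j) = sg j).
Proof.
move=> PF F0 rh hB hs r0.
have [G [UG FG]] := ultraFilterLemma PF.
have cvh j : exists l : R, h j t @[t --> G] --> l.
  have := @segment_compact R (- B) B; rewrite compact_ultra.
  move=> /(_ (fmap (h j) G) (ultra_fmap _ _))[].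
    suff: F (h j @^-1` `[- B, B]) by move=> /FG.
    by move: hB; apply: filterS => t /(_ j); rewrite ler_norml /= in_itv.
  by move=> l [_ hl]; exists l.
pose nu j := xget (0 : R) [set l : R | h j t @[t --> G] --> l].
have cvnu j : h j t @[t --> G] --> nu j.
  by rewrite /nu; case: xgetP => [l _ //|]; have [l hl] := cvh j; move/(_ l).
have lim x : \prod_(j < k) (x - nu j) = (r x).[0].
  have c1 : \prod_(j < k) (x - h j t) @[t --> G] --> \prod_(j < k) (x - nu j).
    apply: cvg_big => [|j _]; first by move=> [u v]; exact: mul_continuous.
    by apply: cvgB; [exact: cvg_cst|exact: cvnu].
  have c2 : (r x).[t] @[t --> G] --> (r x).[0].
    by apply: cvg_comp; [exact: (cvg_trans FG F0)|exact: continuous_horner].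
  apply: (@cvg_unique _ _ (((r x).[t]) @[t --> G])) => //.
  apply: cvg_trans c1; apply: near_eq_cvg.
  by apply: FG; move: (rh x); apply: filterS => t ->.
exists nu; split=> // j.
(* Since [(r 0).[0]] is the product of the [0 - nu j], no limit is 0, and so the signs pass to the
   limit. *)
have nuj : nu j != 0.
  apply: contraNneq r0 => nj; rewrite -lim (bigD1 j) //= nj subrr mul0r //.
have sgG : \forall t \near G, Num.sg (h j t) = sg j by exact: FG (hs j).
have [nn|np|n0] := ltgtP (nu j) 0.
- near G => t; rewrite -(_ : Num.sg (h j t) = sg j); last by near: t.
  by rewrite !ltr0_sg //; near: t; exact: cvgr_lt (cvnu j) _ nn.
- near G => t; rewrite -(_ : Num.sg (h j t) = sg j); last by near: t.
  by rewrite !gtr0_sg //; near: t; exact: cvgr_gt (cvnu j) _ np.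
- by rewrite n0 eqxx in nuj.
Unshelve. all: by end_near.
Qed.

(** The eigenvalues [h j t] of [t *: L - K] have the same multiset of limits from both sides of 0,
    namely the spectrum of [- K], even if the labels [j] are permuted. The sum of the signs depends
    only on this multiset. *)
Lemma sum_sg_left_right (k : nat) (h : 'I_k -> R -> R) (sl sr : 'I_k -> R)
   (L K : 'M[C]_k) : K \in unitmx ->
  (forall t z, t != 0 -> \det (z%:M - (rC t *: L - K)) = \prod_(j < k) (z - rC (h j t))) ->
  (forall j, \forall t \near 0^'-, Num.sg (h j t) = sl j) ->
  (forall j, \forall t \near 0^'+, Num.sg (h j t) = sr j) ->
  \sum_j sl j = \sum_j sr j.
Proof.
move=> uK ch hsl hsr.
(* For fixed [z] the characteristic polynomial of [t *: L - K] at [z] is regarded as a polynomial in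
   [t], which makes sense at [t = 0] too. *)
pose Q (z : C) : {poly C} := \det ((z%:P)%:M - ('X *: map_mx polyC L - map_mx polyC K)).
have QE z (t : C) : (Q z).[t] = \det (z%:M - (t *: L - K)).
  rewrite -[_.[t]]/(horner_eval t _) -det_map_mx; congr (\det _).
  apply/matrixP => i j; rewrite !mxE /= /horner_eval !hornerE.
  by rewrite hornerMn hornerC.
have Qh z t : t != 0 -> (Q z).[rC t] = \prod_(j < k) (z - rC (h j t)).
  by move=> nt; rewrite QE ch.
have rr x : exists r : {poly R}, (forall t, (Q (rC x)).[rC t] = rC r.[t]) /\
    forall t, t != 0 -> r.[t] = \prod_(j < k) (x - h j t).
  apply: real_poly => t nt; rewrite Qh // rmorph_prod; apply: eq_bigr => j _.
  by rewrite rmorphB.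
pose r x := projT1 (cid (rr x)).
have rE x : (forall t, (Q (rC x)).[rC t] = rC (r x).[t]) /\
    forall t, t != 0 -> (r x).[t] = \prod_(j < k) (x - h j t).
  by rewrite /r; case: cid.
have r00 : (r 0).[0] != 0.
  have := (rE 0).1 0; rewrite QE rmorph0 scale0r. rewrite !sub0r opprK => d.
  have : \det K != 0 by rewrite -unitfE -unitmxE.
  by apply: contraNneq => z0; rewrite d z0 rmorph0.
(* Evaluating at +i and -i: \prod_j (1 + h_j^2) is a polynomial in t that bounds every h_j. *)
have [b [_ bE]] : exists b : {poly R}, (forall t, (Q 'i%C * Q (- 'i%C)).[rC t] = rC b.[t]) /\
    forall t, t != 0 -> b.[t] = \prod_(j < k) (1 + h j t ^+ 2).
  apply: real_poly => t nt; rewrite hornerM !Qh // rmorph_prod -big_split /=.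
  apply: eq_bigr => j _; rewrite rmorphD rmorph1 rmorphXn /=.
  have -> : 1 = - ('i%C : C) ^+ 2 by rewrite sqr_i opprK.
  by ring.
(* Near 0, [1 + h j t ^+ 2 <= b.[t] < b.[0] + 1], so [h j t ^+ 2 < b.[0]]; the generous bound [b.[0]
   + 2] avoids a square root. *)
have hb : \forall t \near (0 : R), t != 0 -> forall j, `|h j t| <= b.[0] + 2.
  near=> t => nt j.
  have : b.[t] < b.[0] + 1.
    near: t; apply: (cvgr_lt b.[0]); last by rewrite ltrDl.
    exact: continuous_horner.
  rewrite bE // (bigD1 j) //= => hlt.
  have h1 : 1 + h j t ^+ 2 < b.[0] + 1.
    apply: le_lt_trans hlt; apply: ler_peMr; first by rewrite addr_ge0 ?sqr_ge0.
    have : \prod_(i < k | i != j) (1 : R) <= \prod_(i < k | i != j) (1 + h i t ^+ 2).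
      by apply: ler_prod => i _; rewrite ler01 lerDl sqr_ge0.
    by rewrite big1.
  have : `|h j t| ^+ 2 < b.[0] by rewrite real_normK ?num_real //; lra.
  have := normr_ge0 (h j t); nra.
have side F s : ProperFilter F -> F --> (0 : R) -> (\forall t \near F, t != 0) ->
    (forall j, \forall t \near F, Num.sg (h j t) = s j) ->
    exists nu : 'I_k -> R, (forall x, \prod_(j < k) (x - nu j) = (r x).[0]) /\
     (forall j, Num.sg (nu j) = s j).
  move=> PF F0 Fn hs; apply: (@ultra_limit_roots k F h r (b.[0] + 2)) => //.
    by move=> x; move: Fn; apply: filterS => t /((rE x).2 t).
  by have := F0 _ hb; move: Fn; apply: filterS2 => t nt; apply.
have [nl [nlr nls]] : exists nu : 'I_k -> R, (forall x, \prod_(j < k) (x - nu j) = (r x).[0]) /\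
     (forall j, Num.sg (nu j) = sl j).
  apply: (side (0 : R)^'-) hsl; first exact: cvg_within.
  by near=> t; rewrite lt_eqF //; near: t; exact: nbhs_left_lt.
have [nr [nrr nrs]] : exists nu : 'I_k -> R, (forall x, \prod_(j < k) (x - nu j) = (r x).[0]) /\
     (forall j, Num.sg (nu j) = sr j).
  apply: (side (0 : R)^'+) hsr; first exact: cvg_within.
  by near=> t; rewrite gt_eqF //; near: t; exact: nbhs_right_gt.
pose sq (nu : 'I_k -> R) := [seq nu j | j <- enum 'I_k].
have /prod_XsubC_eq pe : \prod_(z <- sq nl) ('X - z%:P) = \prod_(z <- sq nr) ('X - z%:P).
  apply: poly_ext_neq0 => x _; rewrite !horner_prod.
  under eq_bigr do rewrite hornerXsubC.
  under [RHS]eq_bigr do rewrite hornerXsubC.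
  by rewrite [LHS]big_map [RHS]big_map !big_enum /= nlr nrr.
transitivity (\sum_(z <- sq nl) Num.sg z).
  by rewrite big_map big_enum; apply: eq_bigr.
by rewrite (perm_big _ pe) big_map big_enum; apply: eq_bigr.
Unshelve. all: by end_near. Qed.

(** * Orders of the branches and characteristic values *)

(** The field is algebraically closed and the characteristic polynomial monic, so the set searched
    by [xget] is nonempty. *)
Lemma eig_seqP k (M : 'M[C]_k) : char_poly M = \prod_(z <- eig_seq M) ('X - z%:P).
Proof.
rewrite /eig_seq; case: xgetP => [s _ //|].
have [s sE] := closed_field_poly_normal (char_poly M).
move=> /(_ s); case; rewrite /= sE.
by have /monicP := char_poly_monic M; rewrite sE => ->; rewrite scale1r.
Qed.

(** * One-sided signs at 0 and the Z-numbers *)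

Lemma near_right0E (P : R -> Prop) :
  (exists e : R, 0 < e /\ forall l, 0 < l < e -> P l) <-> \forall l \near 0^'+, P l.
Proof.
split=> [[e [e0 eP]]|].
  near=> l; apply: eP; apply/andP; split; near: l; first exact: nbhs_right_gt.
  exact: nbhs_right_lt.
rewrite /at_right /within /= => /nbhs_ballP[e /= e0 eP]; exists e; split=> // l /andP[l0 le].
by apply: eP => //; rewrite /ball /= sub0r normrN gtr0_norm.
Unshelve. all: by end_near. Qed.

Lemma near_left0E (P : R -> Prop) :
  (exists e : R, 0 < e /\ forall l, - e < l < 0 -> P l) <-> \forall l \near 0^'-, P l.
Proof.
split=> [[e [e0 eP]]|].
  near=> l; apply: eP; apply/andP; split; near: l; last exact: nbhs_left_lt.
  by apply: nbhs_left_gt; rewrite oppr_lt0.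
rewrite /at_left /within /= => /nbhs_ballP[e /= e0 eP]; exists e; split=> // l /andP[le l0].
by apply: eP => //; rewrite /ball /= sub0r normrN ltr0_norm // ltrNl.
Unshelve. all: by end_near. Qed.

Lemma near_sg_lt0 (F : set_system R) (f : R -> R) (s : R) : ProperFilter F ->
  (\forall l \near F, Num.sg (f l) = s) -> (\forall l \near F, f l < 0) <-> s < 0.
Proof.
move=> PF fs; split=> [fn|s0].
  have [l [<- ]] := filter_ex (filterI fs fn).
  by rewrite sgr_lt0.
by near=> l; rewrite -sgr_lt0 (_ : Num.sg (f l) = s) //; near: l.
Unshelve. all: by end_near. Qed.

Lemma near_sg_gt0 (F : set_system R) (f : R -> R) (s : R) : ProperFilter F ->
  (\forall l \near F, Num.sg (f l) = s) -> (\forall l \near F, 0 < f l) <-> 0 < s.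
Proof.
move=> PF fs; split=> [fn|s0].
  have [l [<- ]] := filter_ex (filterI fs fn).
  by rewrite sgr_gt0.
by near=> l; rewrite -sgr_gt0 (_ : Num.sg (f l) = s) //; near: l.
Unshelve. all: by end_near. Qed.

Lemma card_setP k (P : 'I_k -> Prop) (b : 'I_k -> bool) : (forall j, P j <-> b j) ->
  #|[set j : 'I_k | `[< P j >]]%SET| = (\sum_j b j)%N.
Proof.
move=> Pb; rewrite -sum1dep_card [LHS]big_mkcond; apply: eq_bigr => j _.
by case: asboolP => [/Pb ->|nP] //; case: (b j) (Pb j) => // -[_ h]; case: nP; exact: h.
Qed.

Section ZeroIndices.
Variables (k : nat) (mu : 'I_k -> R -> R) (sl sr : 'I_k -> R).
Hypothesis hsr : forall j, \forall l \near 0^'+, Num.sg (mu j l) = sr j.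
Hypothesis hsl : forall j, \forall l \near 0^'-, Num.sg (mu j l) = sl j.

Lemma Zdown_pE : Zdown_p mu = (\sum_j nat_of_bool ((mu j 0 == 0) && (sr j < 0))%R)%N.
Proof.
apply: card_setP => j; have hj := hsr j.
split=> [[/eqP -> /near_right0E/(near_sg_lt0 _ hj)//]|/andP[/eqP -> s0]].
by split=> //; apply/near_right0E/(near_sg_lt0 _ hj).
Qed.

Lemma Zdown_mE : Zdown_m mu = (\sum_j nat_of_bool ((mu j 0 == 0) && (sl j < 0))%R)%N.
Proof.
apply: card_setP => j; have hj := hsl j.
split=> [[/eqP -> /near_left0E/(near_sg_lt0 _ hj)//]|/andP[/eqP -> s0]].
by split=> //; apply/near_left0E/(near_sg_lt0 _ hj).
Qed.

Lemma Zup_pE : Zup_p mu = (\sum_j nat_of_bool ((mu j 0 == 0) && (0 < sr j))%R)%N.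
Proof.
apply: card_setP => j; have hj := hsr j.
split=> [[/eqP -> /near_right0E/(near_sg_gt0 _ hj)//]|/andP[/eqP -> s0]].
by split=> //; apply/near_right0E/(near_sg_gt0 _ hj).
Qed.

Lemma Zup_mE : Zup_m mu = (\sum_j nat_of_bool ((mu j 0 == 0) && (0 < sl j))%R)%N.
Proof.
apply: card_setP => j; have hj := hsl j.
split=> [[/eqP -> /near_left0E/(near_sg_gt0 _ hj)//]|/andP[/eqP -> s0]].
by split=> //; apply/near_left0E/(near_sg_gt0 _ hj).
Qed.
End ZeroIndices.

(** * The determinant of the pencil and the multiplicities of the eigenvalues of JL *)

Lemma det_pencil_eig k (L J : 'M[C]_k) (l : C) : J \in unitmx ->
  \det (pencil L J l) = \det (Kmat J) * (- 'i) ^+ k *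
    \prod_(z <- eig_seq (J *m L)) (- 'i * l - z).
Proof.
move=> uJ; have ni : ('i : C) != 0 by exact: neq0Ci.
have uiJ : 'i *: J \in unitmx by rewrite unitmxZ // unitfE.
(* [Kmat J] is the inverse of ['i *: J], so it turns ['i *: (J *m L)] back into [L]. *)
have -> : pencil L J l = Kmat J *m ((- 'i) *: ((- 'i * l)%:M - J *m L)).
  rewrite scalerBr scale_scalar_mx mulrA mulrNN -expr2 sqrCi mulN1r scaleNr opprK.
  rewrite mulmxDr scalemxAl mulmxA mulVmx // mul1mx mul_mx_scalar.
  by rewrite /pencil scaleNr addrC.
rewrite det_mulmx detZ -mulrA -horner_char_poly eig_seqP horner_prod.
by congr (_ * (_ * _)); apply: eq_bigr => z _; rewrite hornerXsubC.
Qed.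

Lemma det_eig k (A : 'M[C]_k) (c : 'I_k -> C) :
  char_poly A = \prod_(j < k) ('X - (c j)%:P) -> \det A = \prod_j c j.
Proof.
move=> cA; have := congr1 (horner^~ 0) cA.
rewrite horner_char_poly horner_prod raddf0 sub0r -scaleN1r detZ.
under eq_bigr do rewrite hornerXsubC sub0r.
rewrite prodrN card_ord; apply: mulfI.
by rewrite expf_eq0 oppr_eq0 oner_eq0 andbF.
Qed.

(* Squared norms keep the identity between \prod_j mu_j and the characteristic
   polynomial of JL inside R. *)
Lemma prod_branch_sqr k (L J : 'M[C]_k) (mu : 'I_k -> R -> R) : J \in unitmx ->
  (forall l : R, char_poly (pencil L J (rC l)) = \prod_(j < k) ('X - (rC (mu j l))%:P)) ->
  exists2 c : R, c != 0 & forall l, \prod_j mu j l ^+ 2 =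
     c * \prod_(z <- eig_seq (J *m L)) ((l + complex.Im z) ^+ 2 + complex.Re z ^+ 2).
Proof.
move=> uJ ch; pose d := \det (Kmat J).
(* The constant is the squared modulus of the determinant of K; the powers of [- 'i] have modulus
   1. *)
exists (complex.Re d ^+ 2 + complex.Im d ^+ 2).
  have : d != 0.
    rewrite /d /Kmat -unitfE -[_ \is a _]/(_ \in unitmx) unitmx_inv.
    by rewrite unitmxZ // unitfE; exact: neq0Ci.
  by apply: contraNneq => d0; rewrite -normr_eq0 -sqrf_eq0 -add_Re2_Im2 d0.
move=> l; apply: (@complexI R).
have nE (z : C) : `|z| ^+ 2 = rC (complex.Re z ^+ 2 + complex.Im z ^+ 2).
  by rewrite -add_Re2_Im2.
have := congr1 (fun z : C => `|z| ^+ 2) (det_pencil_eig L (rC l) uJ).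
rewrite (det_eig (ch l)) -rmorph_prod nE /= expr0n addr0 -prodrXl.
rewrite !normrM normrX normrN normCi expr1n mulr1 exprMn nE -/d.
rewrite normr_prod -prodrXl => E; rewrite -/(rC _) E.
rewrite -[RHS]/(rC _) rmorphM; congr (_ * _).
rewrite rmorph_prod; apply: eq_bigr => z _; rewrite nE; congr rC.
case: z => a b; rewrite -complexiE; simpc => /=.
by rewrite /rC; simpc; ring.
Qed.

Lemma real_analytic_continuous (f : R -> R) : real_analytic f -> continuous f.
Proof.
by move=> fa x; have [c [r [r0 /expandsE fc]]] := fa x; exact: expands_continuous fc.
Qed.

Lemma seq_norm_bound (s : seq R) : exists2 b : R, 0 < b & forall x, x \in s -> `|x| < b.
Proof.
elim: s => [|y s [b b0 sb]]; first by exists 1.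
exists (`|y| + b); first by rewrite ltr_wpDl.
move=> x; rewrite inE => /predU1P[->|/sb xb]; first by rewrite ltrDl.
by rewrite (lt_le_trans xb) // lerDr.
Qed.

(* -i x is the eigenvalue of JL attached to the real characteristic value x. *)
Definition imag_at (x : R) (z : C) := (complex.Re z == 0) && (- complex.Im z == x).

(** If z = -i x, the factor is [(l - x) ^+ 2]; otherwise it is a sum of two squares that do not both
    vanish at [x]. *)
Lemma eig_factor_order (z : C) x : exists a,
  has_order (fun l => (l + complex.Im z) ^+ 2 + complex.Re z ^+ 2) x (2 * imag_at x z)%N a.
Proof.
case: z => u v; rewrite /imag_at /=.
have cf : {for x, continuous (fun l => (l + v) ^+ 2 + u ^+ 2)}.
  by apply: cvgD; [apply: cvgM; apply: cvgD|]; (exact: cvg_id || exact: cvg_cst).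
have [/andP[/eqP-> /eqP<-]|nuv] := boolP (_ && _).
  exists 1; split; first exact: oner_neq0.
  exists (cst 1); split=> //; first exact: cvg_cst.
  by near=> l; rewrite expr0n addr0 mulr1 opprK.
eexists; apply: (has_order0 cf); apply: contraNneq nuv => /eqP.
by rewrite paddr_eq0 ?sqr_ge0 // !sqrf_eq0 andbC [- v == x]eq_sym -addr_eq0.
Unshelve. all: by end_near. Qed.

Lemma has_order_neq0 (f : R -> R) x m a : has_order f x m a -> ~ (\forall y \near x, f y = 0).
Proof.
move=> fo /near_at_right f0; have fs := has_order_sg_right fo.
near x^'+ => y.
have y0 : f y = 0 by near: y.
have ys : Num.sg (f y) = Num.sg a by near: y.
have : Num.sg a = 0 by rewrite -ys y0 sgr0.
by apply/eqP; rewrite sgr_eq0; case: fo.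
Unshelve. all: by end_near. Qed.

Section Orders.
Variables (k : nat) (mu : 'I_k -> R -> R) (s : seq C) (c : R).
Hypothesis c0 : c != 0.
Hypothesis muE : forall l, \prod_j mu j l ^+ 2 =
   c * \prod_(z <- s) ((l + complex.Im z) ^+ 2 + complex.Re z ^+ 2).

Lemma prod_sqr_order x : exists a,
  has_order (fun l => \prod_j mu j l ^+ 2) x (2 * count (imag_at x) s) a.
Proof.
have [a ha] := has_order_prod s (fun z => eig_factor_order z x).
exists (c * a); rewrite (funext muE).
have -> : (2 * count (imag_at x) s = 0 + \sum_(z <- s) 2 * imag_at x z)%N.
  by rewrite -big_distrr /= -sum1_count -big_mkcond.
apply: has_order_mul ha; exact: (has_order0 (cvg_cst c)).
Qed.

(** A branch vanishing near [x] would make the whole product vanish there, although that product has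
    a finite order. Every branch thus has a finite order at every point. *)
Lemma branch_not_near0 j (x : R) : ~ (\forall y \near x, mu j y = 0).
Proof.
have [a /has_order_neq0 nz] := prod_sqr_order x.
move=> j0; apply: nz; move: j0; apply: filterS => y y0.
by rewrite (bigD1 j) //= y0 expr0n mul0r.
Qed.

(** The product of the squared branches has order [2 * \sum_j m j] by its factors, and twice the
    multiplicity of -i x by the spectrum of JL. Uniqueness of the order identifies the two. *)
Lemma sum_branch_orders x (m : 'I_k -> nat) :
  (forall j, exists a, has_order (mu j) x (m j) a) ->
  (\sum_j m j = count (imag_at x) s)%N.
Proof.
move=> hm; have h2 j : exists a, has_order (fun l => mu j l ^+ 2) x (2 * m j) a.
  by have [a ha] := hm j; exists (a * a); rewrite mul2n -addnn; exact: has_order_mul.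
have [a ha] := has_order_prod (index_enum 'I_k) h2.
have [b hb] := prod_sqr_order x.
apply/eqP; rewrite -(@eqn_pmul2l 2) // big_distrr /=.
by rewrite eqn_leq (has_order_leq ha hb) (has_order_leq hb ha).
Qed.

Lemma branch_eq0 x : (exists j, mu j x = 0) <-> has (imag_at x) s.
Proof.
split=> [[j j0]|].
  have : \prod_j mu j x ^+ 2 == 0 by rewrite (bigD1 j) //= j0 expr0n mul0r.
  rewrite muE mulf_eq0 (negbTE c0) prodf_seq_eq0 /= => /hasP[z zs /= z0].
  apply/hasP; exists z => //; rewrite /imag_at.
  move: z0; rewrite paddr_eq0 ?sqr_ge0 // !sqrf_eq0 => /andP[z1 ->].
  by rewrite eq_sym -addr_eq0.
move=> /hasP[z zs /andP[/eqP r0 /eqP <-]].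
have : \prod_j mu j (- complex.Im z) ^+ 2 == 0.
  rewrite muE mulf_eq0 (negbTE c0) prodf_seq_eq0 /=; apply/hasP; exists z => //=.
  by rewrite addNr r0 expr0n addr0.
by rewrite prodf_seq_eq0 => /hasP[j _ /=]; rewrite sqrf_eq0 => /eqP ?; exists j.
Qed.
End Orders.

Lemma sum_count_imag (s : seq C) (S : seq R) : uniq S ->
  (forall z, z \in s -> complex.Re z = 0 -> - complex.Im z \in S) ->
  (\sum_(x <- S) count (imag_at x) s = count (fun z => complex.Re z == 0%R) s)%N.
Proof.
move=> uS hS; elim: s hS => [|z s IH] hS; first by rewrite big1.
rewrite big_split /= IH; last by move=> w ws; apply: hS; rewrite inE ws orbT.
congr (_ + _)%N; rewrite /imag_at; case: eqP => [r0|_] /=; last by rewrite big1.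
transitivity (count_mem (- complex.Im z) S).
  by rewrite -sum1_count [RHS]big_mkcond; apply: eq_bigr => x _ /=; rewrite eq_sym; case: eqP.
by rewrite count_uniq_mem // hS ?inE ?eqxx.
Qed.

(** * Proof of the index formula *)

Lemma sum_sg_infinity (k : nat) (L J : 'M[C]_k) (mu : 'I_k -> R -> R) (b : R) :
  J \in unitmx -> 0 < b ->
  (forall l : R, char_poly (pencil L J (rC l)) = \prod_(j < k) ('X - (rC (mu j l))%:P)) ->
  (forall j l, b <= l -> Num.sg (mu j l) = Num.sg (mu j b)) ->
  (forall j l, l <= - b -> Num.sg (mu j l) = Num.sg (mu j (- b))) ->
  \sum_j Num.sg (mu j b) + \sum_j Num.sg (mu j (- b)) = 0.
Proof.
move=> uJ b0 ch hb hmb.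
have uK : Kmat J \in unitmx by rewrite unitmx_inv unitmxZ // unitfE; exact: neq0Ci.
have b'0 : 0 < b^-1 by rewrite invr_gt0.
(* For small [t > 0], [t * mu j t^-1] has the sign of [mu j] near +oo; for small [t < 0] the factor
   [t] reverses the sign of [mu j] near -oo. *)
have := @sum_sg_left_right k (fun j t => t * mu j t^-1)
  (fun j => - Num.sg (mu j (- b))) (fun j => Num.sg (mu j b)) L (Kmat J) uK.
rewrite sumrN => h; rewrite -h ?subrr ?addNr //.
- move=> t z nt; have nt' : rC t != 0 by rewrite fmorph_eq0.
  have -> : z%:M - (rC t *: L - Kmat J) = rC t *: ((z / rC t)%:M - pencil L J (rC t^-1)).
    rewrite /pencil scalerBr scalerBr scale_scalar_mx scalerA -rmorphM divff //.
    by rewrite rmorph1 scale1r mulrCA divff ?mulr1.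
  rewrite detZ -horner_char_poly ch horner_prod -[k in _ ^+ k]card_ord -prodr_const -big_split /=.
  apply: eq_bigr => j _; rewrite hornerXsubC mulrBr mulrCA divff // mulr1.
  by rewrite rmorphM.
- move=> j; near=> t.
  have t0 : t < 0 by near: t; exact: nbhs_left_lt.
  rewrite sgrM ltr0_sg // hmb ?mulN1r //.
  rewrite -[t]opprK invrN lerN2 -[b]invrK lef_pV2 ?posrE ?oppr_gt0 //.
  by rewrite lerNl; near: t; apply: nbhs_left_ge; rewrite oppr_lt0.
- move=> j; near=> t.
  have t0 : 0 < t by near: t; exact: nbhs_right_gt.
  rewrite sgrM gtr0_sg // mul1r hb //.
  rewrite -[b]invrK lef_pV2 ?posrE //.
  by near: t; exact: nbhs_right_le.
Unshelve. all: by end_near. Qed.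

Lemma count_zero_branches (k : nat) (L : 'M[C]_k) (c : 'I_k -> R) :
  hermitian_mx L -> char_poly L = \prod_(j < k) ('X - (rC (c j))%:P) ->
  \rank (kermx L) = (\sum_j nat_of_bool (c j == 0%R))%N.
Proof.
move=> hL cL; rewrite (@rank_ker_count0 _ _ L [seq rC (c j) | j <- enum 'I_k]).
- rewrite -sum1_count big_mkcond [LHS]big_map big_enum /=.
  by apply: eq_bigr => j _; rewrite fmorph_eq0; case: eqP.
- exact: rank_hermitian_sqr.
- by rewrite cL [RHS]big_map big_enum.
Qed.

Lemma Nneg_branches (k : nat) (L : 'M[C]_k) (c : 'I_k -> R) :
  char_poly L = \prod_(j < k) ('X - (rC (c j))%:P) ->
  Nneg L = (\sum_j nat_of_bool (c j < 0)%R)%N.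
Proof.
move=> cL; rewrite /Nneg.
have /prod_XsubC_eq/permP -> : \prod_(z <- eig_seq L) ('X - z%:P) =
   \prod_(z <- [seq rC (c j) | j <- enum 'I_k]) ('X - z%:P).
  by rewrite -eig_seqP cL [RHS]big_map big_enum.
rewrite -sum1_count big_mkcond [LHS]big_map big_enum /=.
by apply: eq_bigr => j _; rewrite -[0]/(rC 0) ltcR; case: ltP.
Qed.

Lemma near_right_all (x : R) (t : seq R) : all (> x) t -> \forall w \near x^'+, all (> w) t.
Proof.
elim: t => [|y t IH] /=; first by move=> _; exact: nearW.
by move=> /andP[xy /IH]; apply: filterS2 (nbhs_right_lt xy) => w -> ->.
Qed.

Lemma near_left_all (x : R) (t : seq R) : all (< x) t -> \forall w \near x^'-, all (< w) t.
Proof.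
elim: t => [|y t IH] /=; first by move=> _; exact: nearW.
by move=> /andP[xy /IH]; apply: filterS2 (nbhs_left_gt xy) => w -> ->.
Qed.

(** Here [k] is the size, [N] is N_-(L), [dp dm up um] are the Z-numbers, [r] and [g] are the
    dimensions of ker L and gKer(JL), [cp] and [cm] the multiplicities at positive and negative
    characteristic values, [ct] the total on the imaginary axis, and [b], [b'] the sums of signs
    near +oo and -oo. The terms [k - 2 * N - 2 * dp] and [k - 2 * N - 2 * dm] are the sums of signs
    just right and left of 0. *)
Lemma index_arith (k N dp dm up um r g cp cm ct b b' : R) :
  g + (cp + cm) = ct -> b + b' = 0 -> r = dp + up -> r = dm + um ->
  let S := cp / 2 + (b - (k - 2 * N - 2 * dp)) / 2 / 2 +
           (cm / 2 - ((k - 2 * N - 2 * dm) - b') / 2 / 2) in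
  (k - ct) / 2 = N - (g / 2 - (dp + dm) / 2) - S /\
  (k - ct) / 2 = N - ((g - 2 * r) / 2 + (up + um) / 2) - S.
Proof. by move=> /= *; split; lra. Qed.

End RealAnalysis.

Theorem theorem7 (R : realType) (n : nat) (L J : 'M[complex R]_(n.*2))
    (mu : 'I_(n.*2) -> R -> R) :
  hermitian_mx L -> skew_hermitian_mx J -> J \in unitmx ->
  (forall j, real_analytic (mu j)) ->
  (forall l : R, char_poly (pencil L J (rC l)) =
                 \prod_(j < n.*2) ('X - (rC (mu j l))%:P)) ->
  let n_u : R := (count (fun z : complex R => 'Re z != 0) (eig_seq (J *m L)))%:R / 2 in
  let zeta1 : R := (dim_gker (J *m L))%:R / 2
                   - ((Zdown_p mu)%:R + (Zdown_m mu)%:R) / 2 in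
  let zeta2 : R := ((dim_gker (J *m L))%:R - 2 * (\rank (kermx L))%:R) / 2
                   + ((Zup_p mu)%:R + (Zup_m mu)%:R) / 2 in
  let S : R := sum_charval L J (fun l => 0 < l) (kappa true mu)
             + sum_charval L J (fun l => l < 0) (kappa false mu) in
  n_u = (Nneg L)%:R - zeta1 - S /\ n_u = (Nneg L)%:R - zeta2 - S.
Proof.
move=> hL _ uJ mua ch n_u zeta1 zeta2 S.
have szs : size (eig_seq (J *m L)) = n.*2.
  have := size_char_poly (J *m L).
  by rewrite eig_seqP size_prod_XsubC => -[].
have cgk : dim_gker (J *m L) = count_mem 0 (eig_seq (J *m L)).
  exact: rank_gker_count (eig_seqP _).
have [c c0 muE] := prod_branch_sqr uJ ch.
set s := eig_seq _ in muE szs cgk n_u *.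
have oj j x := real_analytic_vorder (mua j) (@branch_not_near0 _ _ _ _ _ c0 muE j x).
pose a j x := projT1 (cid2 (oj j x)).
pose m j x := vorder (mu j) x.
have mo j x : has_order (mu j) x (m j x) (a j x) by rewrite /a; case: cid2.
have kap j x si : kappa_branch si (mu j) x = (m j x)%:R / 2 +
     (-1) ^+ (~~ si) * (if odd (m j x) then Num.sg (a j x) else 0) / 2.
  by rewrite /a; case: cid2 => /= ? _ ->.
have msum x : (\sum_j m j x = count (imag_at x) s)%N.
  by apply: (sum_branch_orders c0 muE) => j; exists (a j x).
(* Branches not vanishing at [x] have order 0 and contribute nothing, so the sum may run over all
   branches. *)
have kapE si x : kappa si mu x = (count (imag_at x) s)%:R / 2 +
    (-1) ^+ (~~ si) * (\sum_j (if odd (m j x) then Num.sg (a j x) else 0)) / 2.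
  rewrite -msum natr_sum mulr_suml mulr_sumr mulr_suml -big_split /=.
  rewrite /kappa big_mkcond; apply: eq_bigr => j _; rewrite kap.
  rewrite (has_order_vanish (mo j x)); case: posnP => // ->.
  by rewrite mul0r mulr0 mul0r addr0.
(* 0 is put in S0 even if it is not characteristic, so that its term can be split off. *)
pose S0 := sort <=%R (undup (0 :: [seq - complex.Im z | z <- s & complex.Re z == 0])).
have S0E x : (x \in S0) = (x == 0) || has (imag_at x) s.
  rewrite mem_sort mem_undup inE; congr (_ || _); apply/mapP/hasP.
    by move=> [z]; rewrite mem_filter => /andP[z0 zs] ->; exists z; rewrite // /imag_at z0 eqxx.
  by move=> [z zs /andP[z0 /eqP zx]]; exists z; rewrite // mem_filter z0.
have S0s : sorted <%R S0 by rewrite sort_lt_sorted undup_uniq.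
have S0u : uniq S0 by rewrite sort_uniq undup_uniq.
pose Sp := [seq x <- S0 | 0 < x]; pose Sm := [seq x <- S0 | x < 0].
have mu0 j x : x \notin S0 -> mu j x != 0.
  rewrite S0E negb_or => /andP[_]; apply: contraNneq => z0.
  by apply/(branch_eq0 c0 muE); exists j.
(* The condition on [P] discards the point 0, the only one of [S0] that may fail to be
   characteristic. *)
have charval (P : pred R) F : ~~ P 0 ->
    sum_charval L J (fun l => P l) F = \sum_(x <- [seq x <- S0 | P x]) F x.
  move=> P0; rewrite /sum_charval [RHS]fsbig_seq ?filter_uniq //.
  apply: eq_fsbigl; apply/seteqP; split=> l /=; rewrite mem_filter.
    move=> [Pl dl]; rewrite Pl S0E; apply/orP; right; apply/(branch_eq0 c0 muE).
    move/eqP: dl; rewrite (det_eig (ch l)) prodf_seq_eq0 => /hasP[j _ /=].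
    by rewrite fmorph_eq0 => /eqP; exists j.
  move=> /andP[Pl]; rewrite S0E => /predU1P[l0|/(branch_eq0 c0 muE)[j j0]].
    by rewrite l0 (negbTE P0) in Pl.
  by split=> //; rewrite (det_eig (ch l)) (bigD1 j) //= j0 rmorph0 mul0r.
have SE : S = (\sum_(x <- Sp) kappa true mu x) + \sum_(x <- Sm) kappa false mu x.
  by rewrite /S (charval (fun l => 0 < l)) ?ltxx // (charval (fun l => l < 0)) ?ltxx.
have cntE : (count (imag_at 0) s + (\sum_(x <- Sp) count (imag_at x) s +
    \sum_(x <- Sm) count (imag_at x) s) = count (fun z => complex.Re z == 0%R) s)%N.
  rewrite -(sum_count_imag S0u); last first.
    by move=> z zs z0; rewrite S0E; apply/orP; right; apply/hasP; exists z; rewrite // /imag_at z0 !eqxx.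
  rewrite [RHS](bigD1_seq 0%R) ?S0E ?eqxx //= /Sp /Sm !big_filter; congr (_ + _)%N.
  rewrite [RHS](bigID (fun x : R => 0 < x)) /=; congr (_ + _)%N; apply: eq_bigl => x.
    by case: ltgtP.
  by case: ltgtP.
have cont j := real_analytic_continuous (mua j).
(* All real zeros of the branches lie strictly between [- b] and [b], so the signs at these two
   points are the signs at infinity. *)
have [b b0 bS] := seq_norm_bound S0.
have hb j l : b <= l -> Num.sg (mu j l) = Num.sg (mu j b).
  move=> bl; apply/esym/continuous_sg => // y /andP[b_y _]; apply: mu0.
  by apply/negP => /bS; rewrite ltNge (le_trans b_y) // ler_norm.
have hmb j l : l <= - b -> Num.sg (mu j l) = Num.sg (mu j (- b)).
  move=> bl; apply/continuous_sg => // y /andP[_ yb]; apply: mu0.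
  by apply/negP => /bS; rewrite ltNge -normrN (le_trans _ (ler_norm _)) // lerNr.
have inf0 := sum_sg_infinity uJ b0 ch hb hmb.
pose sr j := Num.sg (a j 0); pose sl j := (-1) ^+ m j 0 * Num.sg (a j 0).
have hsr j : (\forall l \near 0^'+, Num.sg (mu j l) = sr j)%classic := has_order_sg_right (mo j 0).
have hsl j : (\forall l \near 0^'-, Num.sg (mu j l) = sl j)%classic := has_order_sg_left (mo j 0).
(* The telescoping starts at a point [w > 0] below every element of [Sp], so close to 0 that [mu j]
   already has the sign [sr j] there. *)
have right j : Num.sg (mu j b) - sr j =
    \sum_(x <- Sp) (if odd (m j x) then Num.sg (a j x) else 0) *+ 2.
  near ((0 : R)^'+)%classic => w.
  have w0 : 0 < w by near: w; exact: nbhs_right_gt.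
  have wb : w < b by near: w; exact: nbhs_right_lt.
  have wS : all (> w) Sp.
    by near: w; apply: near_right_all; exact: filter_all.
  have <- : Num.sg (mu j w) = sr j by near: w; exact: hsr.
  apply: (sg_sum_orders (cont j) (mo j)) => //.
  - exact: sorted_filter lt_trans _ _ S0s.
  - apply/allP => x xS; rewrite (allP wS) //=.
    by move: xS; rewrite mem_filter => /andP[x0 /bS]; rewrite gtr0_norm.
  - exact: ltW.
  - move=> y /andP[wy _]; rewrite mem_filter (lt_le_trans w0 wy) /=; exact: mu0.
have left j : sl j - Num.sg (mu j (- b)) =
    \sum_(x <- Sm) (if odd (m j x) then Num.sg (a j x) else 0) *+ 2.
  near ((0 : R)^'-)%classic => w.
  have w0 : w < 0 by near: w; exact: nbhs_left_lt.
  have wb : - b < w by near: w; apply: nbhs_left_gt; rewrite oppr_lt0.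
  have wS : all (< w) Sm.
    by near: w; apply: near_left_all; exact: filter_all.
  have <- : Num.sg (mu j w) = sl j by near: w; exact: hsl.
  apply: (sg_sum_orders (cont j) (mo j)) => //.
  - exact: sorted_filter lt_trans _ _ S0s.
  - apply/allP => x xS; have xw : x < w := allP wS x xS; rewrite xw andbT.
    by move: xS; rewrite mem_filter => /andP[x0 /bS]; rewrite ltr0_norm // ltrNl.
  - exact: ltW.
  - move=> y /andP[_ yw]; rewrite mem_filter (le_lt_trans yw w0) /=; exact: mu0.
have chL : char_poly L = \prod_(j < n.*2) ('X - (rC (mu j 0))%:P).
  by rewrite -ch /pencil rmorph0 scale0r subr0.
have sgn0 j : mu j 0 != 0 -> sr j = Num.sg (mu j 0) /\ sl j = Num.sg (mu j 0).
  move=> nz; have := has_order_vanish (mo j 0); rewrite (negbTE nz) => /esym/negbT.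
  rewrite -eqn0Ngt => /eqP m0; rewrite /sl m0 expr0 mul1r /sr.
  by have [_ [g [_ <- /nbhs_singleton ->]]] := mo j 0; rewrite m0 expr0 mul1r.
(* On one side of 0 the negative branches are those starting at a negative eigenvalue of [L] and
   those leaving 0 downwards, and all others are positive. Each branch through 0 leaves it either
   down or up, which splits the dimension of ker L. *)
have germ (si : 'I_(n.*2) -> R) :
    (forall j, (mu j 0 != 0 /\ si j = Num.sg (mu j 0)) \/ mu j 0 = 0 /\ (si j = 1 \/ si j = -1)) ->
    \sum_j si j = n.*2%:R - 2 * (Nneg L)%:R
       - 2 * (\sum_j nat_of_bool ((mu j 0 == 0) && (si j < 0))%R)%:R /\
    (\rank (kermx L) = \sum_j nat_of_bool ((mu j 0 == 0) && (si j < 0))%R +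
       \sum_j nat_of_bool ((mu j 0 == 0) && (0 < si j))%R)%N.
  move=> hsi; rewrite (Nneg_branches chL) (count_zero_branches hL chL); split.
    rewrite !natr_sum !mulr_sumr -[X in X%:R - _ - _]card_ord -sumr_const -!sumrB.
    apply: eq_bigr => j _; case: (hsi j) => [[nz ->]|[-> [->|->]]].
    - rewrite (negbTE nz); by case: sgrP nz => //= _ _; lra.
    - rewrite ltxx eqxx ltr10 /=; lra.
    - rewrite ltxx eqxx ltrN10 /=; lra.
  rewrite -big_split; apply: eq_bigr => j _ /=; case: (hsi j) => [[nz ->]|[-> [->|->]]].
  - by rewrite (negbTE nz).
  - by rewrite eqxx ltr10 ltr01.
  - by rewrite eqxx ltrN10 ltr0N1.
have [sumr cr] : \sum_j sr j = n.*2%:R - 2 * (Nneg L)%:R - 2 * (Zdown_p mu)%:R /\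
    (\rank (kermx L) = Zdown_p mu + Zup_p mu)%N.
  rewrite (Zdown_pE hsr) (Zup_pE hsr); apply: germ => j.
  have [m0|/sgn0[-> _]] := eqVneq (mu j 0) 0; last by left.
  right; split=> //; rewrite /sr; have [na _] := mo j 0.
  by case: sgrP na => // _ _; auto.
have [suml cl] : \sum_j sl j = n.*2%:R - 2 * (Nneg L)%:R - 2 * (Zdown_m mu)%:R /\
    (\rank (kermx L) = Zdown_m mu + Zup_m mu)%N.
  rewrite (Zdown_mE hsl) (Zup_mE hsl); apply: germ => j.
  have [m0|/sgn0[_ ->]] := eqVneq (mu j 0) 0; last by left.
  right; split=> //; rewrite /sl -signr_odd; have [na _] := mo j 0.
  by case: (odd _); rewrite ?expr1 ?expr0 ?mul1r ?mulN1r; case: sgrP na => // _ _; rewrite ?opprK; auto.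
pose o j x : R := if odd (m j x) then Num.sg (a j x) else 0.
have Sright : \sum_(x <- Sp) \sum_j o j x = (\sum_j Num.sg (mu j b) - \sum_j sr j) / 2.
  rewrite exchange_big -sumrB mulr_suml; apply: eq_bigr => j _ /=.
  by rewrite right sumrMnl /o -[X in _ = X / 2]mulr_natr mulfK // pnatr_eq0.
have Sleft : \sum_(x <- Sm) \sum_j o j x = (\sum_j sl j - \sum_j Num.sg (mu j (- b))) / 2.
  rewrite exchange_big -sumrB mulr_suml; apply: eq_bigr => j _ /=.
  by rewrite left sumrMnl /o -[X in _ = X / 2]mulr_natr mulfK // pnatr_eq0.
have S2 : S = (\sum_(x <- Sp) count (imag_at x) s)%:R / 2 + (\sum_(x <- Sp) \sum_j o j x) / 2
   + ((\sum_(x <- Sm) count (imag_at x) s)%:R / 2 - (\sum_(x <- Sm) \sum_j o j x) / 2).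
  rewrite SE !natr_sum !mulr_suml -sumrB -big_split /=.
  congr (_ + _); apply: eq_bigr => x _; rewrite kapE /= ?expr0 ?expr1 ?mul1r //.
  by rewrite mulN1r mulNr.
have nuE : n_u = (n.*2%:R - (count (fun z => complex.Re z == 0%R) s)%:R) / 2.
  rewrite /n_u; congr (_ / 2); rewrite -szs.
  rewrite -(count_predC (fun z : complex R => complex.Re z == 0)) natrD addrAC subrr add0r.
  congr _%:R; apply: eq_count => z /=.
  by rewrite -complexRe -[0]/(rC 0) (inj_eq (@complexI R)).
have gk0 : dim_gker (J *m L) = count (imag_at 0) s.
  rewrite cgk; apply: eq_count => -[u v]; rewrite /imag_at /= eq_complex /=.
  by rewrite oppr_eq0.
have /(congr1 (fun q : nat => q%:R : R)) := cntE; rewrite !natrD -gk0 => cntR.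
have crR : (\rank (kermx L))%:R = (Zdown_p mu)%:R + (Zup_p mu)%:R :> R by rewrite cr natrD.
have clR : (\rank (kermx L))%:R = (Zdown_m mu)%:R + (Zup_m mu)%:R :> R by rewrite cl natrD.
rewrite Sright Sleft sumr suml in S2.
by rewrite nuE S2; exact: (index_arith _ _ cntR inf0 crR clR).
Unshelve. all: by end_near. Qed.
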